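(* Suppose there is a representation $R$ that stores an arbitrary permutation $\pi$ of $[n]=\{0,\ldots,n-1\}$ in $s(n)$ bits and supports computing $\pi(i)$ in time $t_f$ and $\pi^{-1}(i)$ in time $t_i$. Then there is a representation of an arbitrary permutation $\pi$ of $[n]$ taking $s(n) + O(n\lg n/\lg\lg n)$ bits in which $\pi^k(i)$, for any $i\in[n]$ and any integer $k$ with $|k| \le n$, can be computed in $t_f + t_i + O(1)$ time; and there is one taking $s(n) + O(\sqrt{n}\lg n)$ bits in which $\pi^k(i)$ can be computed in $t_f + t_i + O(\lg\lg n)$ time.
   Context: $\lg$ denotes the logarithm to base 2. The model of computation is the unit-cost word RAM with words of $\Theta(\lg n)$ bits; space is measured in bits. For a permutation $\pi$, $\pi^0$ is the identity, $\pi^k = \pi\circ\pi^{k-1}$ for $k>0$, and $\pi^{k} = (\pi^{-1})^{-k}$ for $k<0$. *)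

(* Defs.v *)
From HB Require Import structures.
From mathcomp Require Import all_boot all_order all_algebra all_fingroup.
From mathcomp Require Import all_classical all_reals all_analysis.
Import Order.TTheory GRing.Theory Num.Theory.
Import numFieldNormedType.Exports.

Set Implicit Arguments.
Unset Strict Implicit.
Unset Printing Implicit Defensive.

Local Open Scope classical_set_scope.
Local Open Scope nat_scope.

Definition lg {R : realType} (x : R) : R := (ln x / ln 2)%R.

(* The word RAM with w-bit words.  A machine has registers (named by constants
   in the program), a read/write working memory addressed by words, and a
   read-only data structure made of arrays of bits packed w to a word.  Every
   instruction costs one unit. *)

Definition word (w : nat) := 'I_(2 ^ w).

Definition to_word (w x : nat) : word w :=
  Ordinal (ltn_pmod x (expn_gt0 2 w : 0 < 2 ^ w)).

Inductive binop :=
  OpAdd | OpSub | OpMul | OpDiv | OpMod | OpAnd | OpOr | OpXor | OpShl | OpShr.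

(* Arithmetic is modulo 2 ^ w.  Division is total as in ssrnat: a / 0 = 0 and
   a mod 0 = a. *)
Definition eval_op (w : nat) (o : binop) (a b : word w) : word w :=
  to_word w
    match o with
    | OpAdd => a + b
    | OpSub => a + (2 ^ w - b)
    | OpMul => a * b
    | OpDiv => a %/ b
    | OpMod => a %% b
    | OpAnd => Nat.land a b
    | OpOr  => Nat.lor a b
    | OpXor => Nat.lxor a b
    | OpShl => a * 2 ^ b
    | OpShr => a %/ 2 ^ b
    end.

(* r, a, b name registers, j an array of the data structure, l a program line. *)
Inductive instr :=
| Const of nat & nat                (* Const r v      : r := v mod 2 ^ w *)
| Move of nat & nat                 (* Move r a       : r := a *)
| BinOp of binop & nat & nat & nat  (* BinOp o r a b  : r := a o b *)
| LoadMem of nat & nat              (* LoadMem r a    : r := memory[a] *)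
| StoreMem of nat & nat             (* StoreMem a b   : memory[a] := b *)
| ReadData of nat & nat & nat       (* ReadData r j a : r := word a of array j *)
| Jump of nat                       (* Jump l         : go to l *)
| JumpLt of nat & nat & nat         (* JumpLt a b l   : if a < b go to l *)
| JumpEq of nat & nat & nat         (* JumpEq a b l   : if a = b go to l *)
| Halt.

Definition program := seq instr.

Record config (w : nat) := Config {
  pc : nat;
  reg : nat -> word w;
  memory : word w -> word w
}.

(* Bits are packed least significant first; past the end of an array every bit
   reads as 0. *)
Definition read_word (w : nat) (s : bitseq) (a : nat) : word w :=
  to_word w (\sum_(k < w) nth false s (a * w + k) * 2 ^ k).

Definition upd (A : eqType) (B : Type) (f : A -> B) (a : A) (b : B) : A -> B :=
  fun x => if x == a then b else f x.

Definition fetch (P : program) (l : nat) : instr := nth Halt P l.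

(* A halted configuration is a fixed point of step. *)
Definition step (w : nat) (P : program) (D : seq bitseq) (c : config w) :
    config w :=
  let: Config l g m := c in
  match fetch P l with
  | Const r v => Config l.+1 (upd g r (to_word w v)) m
  | Move r a => Config l.+1 (upd g r (g a)) m
  | BinOp o r a b => Config l.+1 (upd g r (eval_op o (g a) (g b))) m
  | LoadMem r a => Config l.+1 (upd g r (m (g a))) m
  | StoreMem a b => Config l.+1 g (upd m (g a) (g b))
  | ReadData r j a =>
      Config l.+1 (upd g r (read_word w (nth [::] D j) (g a))) m
  | Jump l' => Config l' g m
  | JumpLt a b l' => Config (if (g a < g b)%N then l' else l.+1) g m
  | JumpEq a b l' => Config (if g a == g b then l' else l.+1) g m
  | Halt => c
  end.

Definition halted (w : nat) (P : program) (c : config w) : bool :=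
  if fetch P (pc c) is Halt then true else false.

(* With the arguments in registers 0, 1, ... and D as data structure, P reaches
   Halt after at most t instructions with out in register 0.  The remaining
   registers and the working memory are uninitialised (they may hold what
   earlier queries left there), so they carry no information. *)
Definition computes (w : nat) (P : program) (D : seq bitseq) (args : seq nat)
    (out t : nat) : Prop :=
  forall c : config w,
    pc c = 0 ->
    (forall j, j < size args -> reg c j = nth 0 args j :> nat) ->
    let c' := iter t (step P D) c in
    halted P c' /\ reg c' 0 = out :> nat.

(* Theta(lg n) bits per word, and a word can hold the number n; in particular
   the arguments of the queries below do fit in words. *)
Definition word_size (R : realType) (w : nat -> nat) : Prop :=
  (forall n, n < 2 ^ w n) /\
  ((fun n => (w n)%:R : R^o) =Theta_\oo (fun n => lg n%:R : R^o))%R.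

Definition encoding := forall n, 'S_n -> seq bitseq.

(* The structure consists of a constant number of arrays whose lengths depend on
   n only, so that the lengths carry no information on the permutation. *)
Definition occupies (enc : encoding) (s : nat -> nat) : Prop :=
  exists (m : nat) (len : forall n : nat, m.-tuple nat),
    forall n, sumn (len n) <= s n /\
      forall pi : 'S_n, shape (enc n pi) = len n.

Definition perm_expz (n : nat) (pi : 'S_n) (k : int) : 'S_n :=
  match k with
  | Posz m => (pi ^+ m)%g
  | Negz m => (pi^-1 ^+ m.+1)%g
  end.

Definition perm_representation (w s tf ti : nat -> nat) : Prop :=
  exists (enc : encoding) (Pf Pi : program),
    occupies enc s /\
    forall (n : nat) (pi : 'S_n) (i : 'I_n),
      computes (w n) Pf (enc n pi) [:: n; val i] (pi i) (tf n) /\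
      computes (w n) Pi (enc n pi) [:: n; val i] (pi^-1 i)%g (ti n).

(* The exponent is passed as its absolute value and its sign (1 if negative). *)
Definition power_representation (w s t : nat -> nat) : Prop :=
  exists (enc : encoding) (P : program),
    occupies enc s /\
    forall (n : nat) (pi : 'S_n) (i : 'I_n) (k : int),
      absz k <= n ->
      computes (w n) P (enc n pi)
        [:: n; val i; absz k; nat_of_bool (k < 0)%R] (perm_expz pi k i) (t n).

(* Main.v *)
Require Import Defs.
From HB Require Import structures.
From mathcomp Require Import all_boot all_order all_algebra all_fingroup.
From mathcomp Require Import all_classical all_reals all_analysis.
From mathcomp Require Import zify ring lra.
From Stdlib Require PeanoNat.
Import Order.TTheory GRing.Theory Num.Theory.
Import numFieldNormedType.Exports.
Local Open Scope classical_set_scope.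
Local Open Scope nat_scope.

Set Implicit Arguments.
Unset Strict Implicit.
Unset Printing Implicit Defensive.

(* Write the cycles of pi one after the other and let psi be the permutation
   sending a position of this list to the element found there.  Given psi in R,
   pi^k(i) is psi(y), where y is obtained by rotating x = psi^-1(i) by k inside
   its cycle, so it is enough to know the start and the length of the cycle of
   x.  If cycles of equal length are grouped, these follow from the start of the
   group and the common length.

   There are O(sqrt n) groups, and a single structure of O(sqrt n) words that
   finds the group of x in constant time gives both bounds.  Order the groups by
   increasing size.  The groups up to that of x have distinct cycle lengths,
   each at most the size S of the group of x, so x < S^2.  Hence an interval of
   length at most sqrt y starting at y meets at most two groups.  Cutting the
   positions into such intervals takes about the sum of 1 / sqrt y, which is
   O(sqrt n), and for each of them the two candidate groups are tabulated. *)

(** * Sequential composition of word-RAM programs *)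

(** [computes] speaks of register 0 only. Composition also needs the registers that one stage leaves
    for later ones, hence complete start and end states. *)
Definition run (w : nat) (P : program) (D : seq bitseq) (t : nat)
    (g : nat -> word w) (m : word w -> word w)
    (g' : nat -> word w) (m' : word w -> word w) : Prop :=
  exists l, iter t (step P D) (Config 0 g m) = Config l g' m' /\
    halted P (Config l g' m').

Lemma step_halted (w : nat) (P : program) (D : seq bitseq) (c : config w) :
  halted P c -> step P D c = c.
Proof. by case: c => l g m; rewrite /halted /step /=; case: (fetch P l). Qed.

Lemma iter_step_halted (w : nat) (P : program) (D : seq bitseq) (c : config w)
    (t u : nat) :
  halted P (iter t (step P D) c) ->
  iter (u + t) (step P D) c = iter t (step P D) c.
Proof.
by move=> h; rewrite iterD; elim: u => //= u ->; rewrite step_halted.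
Qed.

Lemma run_leq (w : nat) (P : program) (D : seq bitseq) (t u : nat)
    (g g' : nat -> word w) (m m' : word w -> word w) :
  t <= u -> run P D t g m g' m' -> run P D u g m g' m'.
Proof.
move=> letu [l [E h]]; exists l; split=> //.
by rewrite -(subnK letu) iter_step_halted E.
Qed.

Lemma computes_run (w : nat) (P : program) (D : seq bitseq) (args : seq nat)
    (out t : nat) (g : nat -> word w) (m : word w -> word w) :
  computes w P D args out t ->
  (forall j, j < size args -> g j = nth 0 args j :> nat) ->
  exists g' m', run P D t g m g' m' /\ g' 0 = out :> nat.
Proof.
move=> /(_ (Config 0 g m) erefl) H /H [].
by case E: (iter _ _ _) => [l g' m'] h r; exists g', m'; split=> //; exists l.
Qed.

Lemma run_computes (w : nat) (P : program) (D : seq bitseq) (args : seq nat)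
    (out t : nat) :
  (forall (g : nat -> word w) (m : word w -> word w),
    (forall j, j < size args -> g j = nth 0 args j :> nat) ->
    exists g' m', run P D t g m g' m' /\ g' 0 = out :> nat) ->
  computes w P D args out t.
Proof.
move=> H [l g m] /= -> /(H g m) [g' [m' [[l' [E h]] r]]].
by rewrite E.
Qed.

Definition clip_instr (e : nat) (i : instr) : instr :=
  match i with
  | Jump l => Jump (minn l e)
  | JumpLt a b l => JumpLt a b (minn l e)
  | JumpEq a b l => JumpEq a b (minn l e)
  | Halt => Jump e
  | _ => i
  end.

Definition shift_instr (o : nat) (i : instr) : instr :=
  match i with
  | Jump l => Jump (o + l)
  | JumpLt a b l => JumpLt a b (o + l)
  | JumpEq a b l => JumpEq a b (o + l)
  | _ => i
  end.

(* Clipping turns every way in which P can stop, including falling off its end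
   and jumping out of it, into a transfer of control to the first line of Q. *)
Definition seqp (P Q : program) : program :=
  [seq clip_instr (size P) i | i <- P] ++ [seq shift_instr (size P) i | i <- Q].

Lemma fetch_seqp_left (P Q : program) (l : nat) : l < size P ->
  fetch (seqp P Q) l = clip_instr (size P) (fetch P l).
Proof. by move=> h; rewrite /fetch nth_cat size_map h (nth_map Halt). Qed.

Lemma fetch_seqp_right (P Q : program) (l : nat) :
  fetch (seqp P Q) (size P + l) = shift_instr (size P) (fetch Q l).
Proof.
rewrite /fetch nth_cat size_map ltnNge leq_addr /= addKn.
have [lt|ge] := ltnP l (size Q); first by rewrite (nth_map Halt).
by rewrite !nth_default // size_map.
Qed.

Lemma step_seqp_left (w : nat) (P Q : program) (D : seq bitseq) (l : nat)
    (g : nat -> word w) (m : word w -> word w) :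
  ~~ halted P (Config l g m) ->
  l < size P /\
  let: Config l' g' m' := step P D (Config l g m) in
  step (seqp P Q) D (Config l g m) = Config (minn l' (size P)) g' m'.
Proof.
rewrite /halted /= => h; have lt: l < size P.
  by apply: contraNT h; rewrite -leqNgt /fetch => /(nth_default Halt) ->.
split=> //; rewrite /step fetch_seqp_left //.
have E : minn l.+1 (size P) = l.+1 by apply/minn_idPl.
case: (fetch P l) h => //= *; rewrite ?E //.
all: by case: ifP => _; rewrite ?E.
Qed.

Lemma step_seqp_right (w : nat) (P Q : program) (D : seq bitseq) (l : nat)
    (g : nat -> word w) (m : word w -> word w) :
  step (seqp P Q) D (Config (size P + l) g m) =
  let: Config l' g' m' := step Q D (Config l g m) in
  Config (size P + l') g' m'.
Proof.
rewrite /step fetch_seqp_right.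
case: (fetch Q l) => //= *; rewrite ?addnS //.
all: by case: ifP => _; rewrite ?addnS.
Qed.

(** The invariant is that the composed program has its counter clipped to [size P]. The one extra
    instruction is the jump that replaces [Halt]; any other way of leaving [P] lands on [size P] at
    once. *)
Lemma iter_seqp_left (w : nat) (P Q : program) (D : seq bitseq) (t l l' : nat)
    (g g' : nat -> word w) (m m' : word w -> word w) :
  iter t (step P D) (Config l g m) = Config l' g' m' ->
  halted P (Config l' g' m') ->
  exists2 u, u <= t.+1 &
    iter u (step (seqp P Q) D) (Config (minn l (size P)) g m) =
    Config (size P) g' m'.
Proof.
elim: t l g m => [|t IH] l g m.
  case=> -> -> -> h; have [lt|ge] := ltnP l' (size P); last first.
    by exists 0; rewrite //= ?(minn_idPr ge).
  exists 1; rewrite //= fetch_seqp_left //.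
  by move: h; rewrite /halted /=; case: (fetch P l').
rewrite iterSr; case: (boolP (halted P (Config l g m))) => h.
  rewrite step_halted // => /IH {}IH /IH [u le E].
  by exists u => //; apply: leqW.
have [lt] := step_seqp_left Q D h.
case: (step P D _) => l1 g1 m1 E /IH {}IH /IH [u le E'].
by exists u.+1; rewrite // iterSr (minn_idPl (ltnW lt)) E.
Qed.

Lemma iter_seqp_right (w : nat) (P Q : program) (D : seq bitseq) (t l l' : nat)
    (g g' : nat -> word w) (m m' : word w -> word w) :
  iter t (step Q D) (Config l g m) = Config l' g' m' ->
  iter t (step (seqp P Q) D) (Config (size P + l) g m) =
  Config (size P + l') g' m'.
Proof.
elim: t l' g' m' => [|t IH] l' g' m' /=; first by case=> -> -> ->.
case: (iter t (step Q D) _) IH => l1 g1 m1 /(_ _ _ _ erefl) -> E.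
by rewrite step_seqp_right E.
Qed.

Lemma run_seqp (w : nat) (P Q : program) (D : seq bitseq) (t u : nat)
    (g g1 g2 : nat -> word w) (m m1 m2 : word w -> word w) :
  run P D t g m g1 m1 -> run Q D u g1 m1 g2 m2 ->
  run (seqp P Q) D (t + u + 1) g m g2 m2.
Proof.
move=> [l [E h]] [l' [E' h']].
have [k le] := iter_seqp_left Q E h; rewrite min0n => Ek.
have /(iter_seqp_right P) := E'; rewrite addn0 => Er.
apply: (@run_leq _ _ _ (u + k)); first by lia.
exists (size P + l'); rewrite iterD Ek Er; split=> //.
by move: h'; rewrite /halted /= fetch_seqp_right; case: (fetch Q l').
Qed.

(** * Registers and arrays out of reach of a program *)

Definition instr_dst (i : instr) : nat :=
  match i with
  | Const r _ | Move r _ | BinOp _ r _ _ | LoadMem r _ | ReadData r _ _ => r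
  | _ => 0
  end.

Definition instr_array (i : instr) : nat :=
  if i is ReadData _ j _ then j else 0.

Definition reg_bound (P : program) : nat := (\max_(i <- P) instr_dst i).+1.

Definition array_bound (P : program) : nat := (\max_(i <- P) instr_array i).+1.

Lemma fetch_bound (f : instr -> nat) (P : program) (l : nat) :
  f Halt = 0 -> f (fetch P l) < (\max_(i <- P) f i).+1.
Proof.
move=> fH; rewrite ltnS /fetch; elim: P l => [|i P IH] [|l] /=; rewrite ?fH //.
  by rewrite big_cons leq_maxl.
by rewrite big_cons leq_max IH orbT.
Qed.

Lemma step_frame (w : nat) (P : program) (D : seq bitseq) (c : config w)
    (r : nat) : reg_bound P <= r -> reg (step P D c) r = reg c r.
Proof.
case: c => l g m le; have := fetch_bound P l (erefl (instr_dst Halt)).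
rewrite -/(reg_bound P) /= => /leq_trans /(_ le).
by case: (fetch P l) => //= *; rewrite /upd gtn_eqF.
Qed.

(** Lets the query keep its arguments in high registers while the unknown program for the inverse
    runs. *)
Lemma run_frame (w : nat) (P : program) (D : seq bitseq) (t : nat)
    (g g' : nat -> word w) (m m' : word w -> word w) (r : nat) :
  run P D t g m g' m' -> reg_bound P <= r -> g' r = g r.
Proof.
move=> [l [E _]] le; have -> : g' = reg (Config l g' m') by [].
rewrite -E; elim: t {E} => //= t IH; by rewrite step_frame.
Qed.

Lemma step_eq_data (w : nat) (P : program) (D D' : seq bitseq) (c : config w) :
  (forall j, j < array_bound P -> nth [::] D j = nth [::] D' j) ->
  step P D c = step P D' c.
Proof.
case: c => l g m H; have := fetch_bound P l (erefl (instr_array Halt)).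
rewrite -/(array_bound P) /=.
by case: (fetch P l) => //= r j a /H ->.
Qed.

(** A program names finitely many arrays, so new ones placed from [array_bound P] on do not disturb
    it. *)
Lemma run_eq_data (w : nat) (P : program) (D D' : seq bitseq) (t : nat)
    (g g' : nat -> word w) (m m' : word w -> word w) :
  (forall j, j < array_bound P -> nth [::] D j = nth [::] D' j) ->
  run P D t g m g' m' -> run P D' t g m g' m'.
Proof.
move=> H [l [E h]]; exists l; split=> //; rewrite -E.
by apply: eq_iter => c; rewrite (step_eq_data _ H).
Qed.

(** * Arrays of words *)

Lemma nth_flatten_uniform (T : Type) (x0 : T) (ss : seq (seq T)) (l a b : nat) :
  all (fun s => size s == l) ss -> b < l ->
  nth x0 (flatten ss) (a * l + b) = nth x0 (nth [::] ss a) b.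
Proof.
move=> + lt; elim: ss a => [|s ss IH] a /=; first by rewrite !nth_nil.
case/andP=> /eqP sl /IH {}IH; rewrite nth_cat sl; case: a => [|a] /=.
  by rewrite mul0n add0n lt.
by rewrite mulSn -addnA ltnNge leq_addr /= addKn IH.
Qed.

Definition pack (w : nat) (f : nat -> nat) (N : nat) : bitseq :=
  flatten (mkseq (fun a => mkseq (fun k => odd (f a %/ 2 ^ k)) w) N).

Lemma size_pack (w : nat) (f : nat -> nat) (N : nat) :
  size (pack w f N) = N * w.
Proof.
rewrite size_flatten /shape -map_comp (eq_map (g := fun=> w)).
  rewrite -[in RHS](size_iota 0 N).
  by elim: (iota 0 N) => //= a s ->; rewrite mulSn.
by move=> a /=; rewrite size_mkseq.
Qed.

Lemma sum_bits (w v : nat) : \sum_(k < w) odd (v %/ 2 ^ k) * 2 ^ k = v %% 2 ^ w.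
Proof.
elim: w => [|w IH]; first by rewrite big_ord0 modn1.
rewrite big_ord_recr /= IH.
have -> : odd (v %/ 2 ^ w) = v %/ 2 ^ w %% 2 :> nat by rewrite modn2.
rewrite expnS [2 * _]mulnC.
have : 0 < 2 ^ w by rewrite expn_gt0.
move: (2 ^ w) => d d0.
(* With d for [2 ^ w], v is split at bit w and its upper part at the next bit. *)
have E : v = v %/ d %/ 2 * (d * 2) + (v %% d + v %/ d %% 2 * d).
  rewrite {1}(divn_eq v d) {1}(divn_eq (v %/ d) 2); ring.
rewrite [in RHS]E modnMDl [RHS]modn_small //.
have := ltn_pmod v d0; have := ltn_pmod (v %/ d) (isT : 0 < 2).
by case: (_ %% 2) => [|[|]] //; lia.
Qed.

Lemma read_pack (w : nat) (f : nat -> nat) (N a : nat) : a < N ->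
  read_word w (pack w f N) a = to_word w (f a).
Proof.
move=> lt; apply: val_inj; rewrite /= -(modn_mod (f a)) -(sum_bits w (f a)).
congr (_ %% _); apply: eq_bigr => k _.
rewrite nth_flatten_uniform //; last first.
  by apply/allP => s /mapP [b _ ->]; rewrite size_mkseq.
by rewrite !nth_mkseq.
Qed.

(** * Cycles grouped by length *)

Lemma partition_porbits (T : finType) (p : {perm T}) :
  finset.partition (porbits p) [set: T]%SET.
Proof.
rewrite /finset.partition; apply/and3P; split.
- apply/eqP/setP=> x; rewrite inE; apply/bigcupP; exists (porbit p x).
    exact: imset_f.
  exact: porbit_id.
- apply/finset.trivIsetP => _ _ /imsetP [x _ ->] /imsetP [y _ ->].
  apply: contraR => /pred0Pn [z /andP [/= zx zy]].
  by move: zx zy; rewrite -!eq_porbit_mem => /eqP <- /eqP ->.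
- apply/negP => /imsetP [x _ E].
  by have := porbit_id p x; rewrite -E inE.
Qed.

(** The first element is an arbitrary choice; listing the rest in the order of [p] is what turns
    powers into rotations. *)
Definition porbit_list (T : finType) (p : {perm T}) (A : {set T}) : seq T :=
  if [pick x in A] is Some x then traject p x #|A| else [::].

Lemma porbit_listP (T : finType) (p : {perm T}) (A : {set T}) :
  A \in porbits p ->
  exists2 x, A = porbit p x & porbit_list p A = traject p x #|porbit p x|.
Proof.
case/imsetP => y _ ->; rewrite /porbit_list; case: pickP => [x|/(_ y)].
  by rewrite -eq_porbit_mem => /eqP <-; exists x.
by rewrite porbit_id.
Qed.

Definition porbits_of_size (T : finType) (p : {perm T}) (l : nat) :=
  [seq A : {set T} <- enum (porbits p) | #|A| == l].

Definition cycles_of_size (T : finType) (p : {perm T}) (l : nat) :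
    seq (seq T) :=
  [seq porbit_list p A | A <- porbits_of_size p l].

(* The layout puts the cycles of equal length side by side; [span p l] is the
   size of the group of those of length l.  Groups come by increasing span. *)
Definition span (T : finType) (p : {perm T}) (l : nat) : nat :=
  l * size (porbits_of_size p l).

Definition lengths (T : finType) (p : {perm T}) : seq nat :=
  sort (relpre (span p) leq) [seq l <- iota 1 #|T| | 0 < span p l].

Definition spans (T : finType) (p : {perm T}) : seq nat :=
  map (span p) (lengths p).

Definition cycle_layout (T : finType) (p : {perm T}) : seq T :=
  flatten [seq flatten (cycles_of_size p l) | l <- lengths p].

Lemma mem_porbits_of_size (T : finType) (p : {perm T}) (l : nat) (A : {set T}) :
  (A \in porbits_of_size p l) = (A \in porbits p) && (#|A| == l).
Proof. by rewrite mem_filter mem_enum andbC. Qed.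

Lemma size_cycles_of_size (T : finType) (p : {perm T}) (l : nat) :
  all (fun s => size s == l) (cycles_of_size p l).
Proof.
apply/allP => _ /mapP [A + ->]; rewrite mem_porbits_of_size.
case/andP=> /porbit_listP [x -> ->] /eqP <-.
by rewrite size_traject.
Qed.

Lemma size_flatten_uniform (T : Type) (ss : seq (seq T)) (l : nat) :
  all (fun s => size s == l) ss -> size (flatten ss) = l * size ss.
Proof.
elim: ss => [|s ss IH] /=; first by rewrite muln0.
by case/andP=> /eqP sl /IH; rewrite size_cat mulnS sl => ->.
Qed.

Lemma shape_cycle_layout (T : finType) (p : {perm T}) :
  shape [seq flatten (cycles_of_size p l) | l <- lengths p] = spans p.
Proof.
rewrite /shape -map_comp; apply: eq_map => l /=.
by rewrite (size_flatten_uniform (size_cycles_of_size p l)) size_map.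
Qed.

Lemma mem_lengths (T : finType) (p : {perm T}) (l : nat) :
  (l \in lengths p) = (0 < l <= #|T|) && (0 < span p l).
Proof. by rewrite mem_sort mem_filter mem_iota add1n ltnS andbC. Qed.

Lemma lengths_uniq (T : finType) (p : {perm T}) : uniq (lengths p).
Proof. by rewrite sort_uniq filter_uniq // iota_uniq. Qed.

Lemma porbit_lengths (T : finType) (p : {perm T}) (x : T) :
  #|porbit p x| \in lengths p.
Proof.
have h : 0 < #|porbit p x| by rewrite lt0n card_porbit_neq0.
rewrite mem_lengths h max_card /= muln_gt0 h /=.
have : porbit p x \in porbits_of_size p #|porbit p x|.
  by rewrite mem_porbits_of_size eqxx andbT imset_f.
by case: (porbits_of_size _ _).
Qed.

(** Double counting: the points are counted cycle by cycle, and a cycle [A] contributes [#|A|] to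
    the group of length [#|A|] and nothing to the others. *)
Lemma sumn_spans (T : finType) (p : {perm T}) : sumn (spans p) = #|T|.
Proof.
rewrite -finset.cardsT (card_partition (partition_porbits p)) sumnE big_map.
rewrite (perm_big _ (permEl (perm_sort _ _))) /= big_filter big_mkcond /=.
under eq_bigr => l _.
  have -> : (if 0 < span p l then span p l else 0) =
      \sum_(A in porbits p) (#|A| == l) * l.
    rewrite lt0n; have -> : (if span p l != 0 then span p l else 0) = span p l.
      by case: eqP => [->|].
    rewrite /span mulnC -big_distrl /= -sum1_size big_filter big_mkcond.
    by rewrite big_enum.
  over.
rewrite exchange_big /=; apply: eq_bigr => _ /imsetP [x _ ->].
rewrite (bigD1_seq #|porbit p x|) ?iota_uniq //=; last first.
  by rewrite mem_iota add1n ltnS max_card lt0n card_porbit_neq0.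
by rewrite eqxx mul1n big1 ?addn0 // => l /negPf; rewrite eq_sym => ->.
Qed.

Lemma mem_cycle_layout (T : finType) (p : {perm T}) (x : T) :
  x \in cycle_layout p.
Proof.
apply/flattenP; exists (flatten (cycles_of_size p #|porbit p x|)).
  by apply/mapP; exists #|porbit p x|; rewrite ?porbit_lengths.
have hA : porbit p x \in porbits p by rewrite imset_f.
apply/flattenP; exists (porbit_list p (porbit p x)).
  by apply/mapP; exists (porbit p x); rewrite // mem_porbits_of_size hA eqxx.
by have [y E ->] := porbit_listP hA; rewrite -porbit_traject -E porbit_id.
Qed.


Lemma size_cycle_layout (T : finType) (p : {perm T}) :
  size (cycle_layout p) = #|T|.
Proof. by rewrite size_flatten shape_cycle_layout sumn_spans. Qed.

(** A list of [#|T|] entries that contains all of [T] has no repetition. *)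
Lemma cycle_layout_uniq (T : finType) (p : {perm T}) : uniq (cycle_layout p).
Proof.
apply: (@leq_size_uniq _ (enum T)); first exact: enum_uniq.
  by move=> x _; apply: mem_cycle_layout.
by rewrite size_cycle_layout cardE.
Qed.


(** The layout is a concatenation of groups, so positions decompose by the index calculus of
    [flatten] and [reshape]. *)
Definition group_index (T : finType) (p : {perm T}) (x : nat) : nat :=
  reshape_index (spans p) x.

Definition group_start (T : finType) (p : {perm T}) (x : nat) : nat :=
  sumn (take (group_index p x) (spans p)).

Definition group_length (T : finType) (p : {perm T}) (x : nat) : nat :=
  nth 0 (lengths p) (group_index p x).

Lemma group_index_lt (T : finType) (p : {perm T}) (x : nat) :
  x < #|T| -> group_index p x < size (lengths p).
Proof.
by rewrite -(sumn_spans p) => /reshape_indexP; rewrite size_map.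
Qed.

Lemma group_length_mem (T : finType) (p : {perm T}) (x : nat) :
  x < #|T| -> group_length p x \in lengths p.
Proof. by move=> lt; rewrite mem_nth // group_index_lt. Qed.

Lemma group_length_gt0 (T : finType) (p : {perm T}) (x : nat) :
  x < #|T| -> 0 < group_length p x.
Proof.
by move/(group_length_mem p); rewrite mem_lengths => /andP [/andP []].
Qed.

Lemma group_length_leq (T : finType) (p : {perm T}) (x : nat) :
  x < #|T| -> group_length p x <= #|T|.
Proof.
by move/(group_length_mem p); rewrite mem_lengths => /andP [/andP []].
Qed.

Lemma group_start_leq (T : finType) (p : {perm T}) (x : nat) :
  group_start p x <= x.
Proof.
by rewrite -[leqRHS](reshape_indexK (spans p)) leq_addr.
Qed.

Lemma group_bound (T : finType) (p : {perm T}) (x : nat) : x < #|T| ->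
  x < group_start p x + span p (group_length p x).
Proof.
move=> lt; rewrite -{1}(reshape_indexK (spans p) x) ltn_add2l.
rewrite -(nth_map 0 0 (span p)) ?group_index_lt //.
by apply: reshape_offsetP; rewrite sumn_spans.
Qed.

(** All cycles of a group have the same length l, so dividing the offset in the group by l gives the
    cycle, and the remainder gives the place in it; z is the first element of that cycle. *)
Lemma nth_cycle_layout (T : finType) (p : {perm T}) (z0 : T) (x : nat) :
  x < #|T| ->
  let l := group_length p x in
  let a := (x - group_start p x) %/ l in
  exists z : T, iter l p z = z /\
    forall b, b < l ->
      nth z0 (cycle_layout p) (group_start p x + (a * l + b)) = iter b p z.
Proof.
move=> lt l a; have l0 : 0 < l := group_length_gt0 p lt.
(* The offset is below the span, which is l times the number of cycles. *)
have la : a < size (porbits_of_size p l).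
  rewrite ltn_divLR // mulnC -/(span p l).
  by rewrite ltn_subLR ?group_start_leq // group_bound.
set A := nth finset.set0 (porbits_of_size p l) a.
have : A \in porbits_of_size p l by rewrite mem_nth.
rewrite mem_porbits_of_size => /andP [/porbit_listP [z EA El] /eqP sA].
exists z; split; first by rewrite -sA EA iter_porbit.
move=> b lb; have lab : a * l + b < span p l by rewrite /span; nia.
have gl : group_index p x < size (lengths p) := group_index_lt p lt.
have E : nth 0 (spans p) (group_index p x) = span p l by rewrite (nth_map 0).
(* The position is the [flatten_index] of a group and an offset, so the lookup takes place inside
   that group. *)
rewrite /group_start -/(flatten_index _ _ _) nth_flatten shape_cycle_layout.
rewrite flatten_indexKl ?E // flatten_indexKr ?E //.
rewrite (nth_map 0) // nth_flatten_uniform ?size_cycles_of_size //.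
rewrite (nth_map finset.set0) // El -EA sA.
by rewrite (set_nth_default z) ?size_traject // nth_traject.
Qed.

(** * Growth of the spans and the two candidate groups *)

Lemma spans_sorted (T : finType) (p : {perm T}) : sorted leq (spans p).
Proof.
by rewrite sorted_map; apply: sort_sorted => x y; apply: leq_total.
Qed.

Lemma span_monotone (T : finType) (p : {perm T}) (i j : nat) :
  i <= j -> j < size (lengths p) ->
  span p (nth 0 (lengths p) i) <= span p (nth 0 (lengths p) j).
Proof.
move=> ij lt; have lti := leq_ltn_trans ij lt.
rewrite -!(nth_map 0 0 (span p)) //.
apply: (sorted_leq_nth leq_trans leqnn _ (spans_sorted p)) => //.
all: by rewrite inE size_map.
Qed.

(* The groups up to the i-th one have distinct lengths, each at most its span,
   hence there are at most [span] of them, and none is larger than the i-th. *)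
Lemma sumn_take_spans (T : finType) (p : {perm T}) (i : nat) :
  i < size (lengths p) ->
  sumn (take i.+1 (spans p)) <= span p (nth 0 (lengths p) i) ^ 2.
Proof.
move=> lt; set s := span p _.
have le x : x \in take i.+1 (lengths p) -> span p x <= s.
  case/(nthP 0) => j; rewrite size_takel // => ji <-.
  by rewrite nth_take // span_monotone.
have sz : size (take i.+1 (lengths p)) = i.+1 by rewrite size_takel.
have card : i.+1 <= s.
  rewrite -sz -[leqRHS](size_iota 1); apply: uniq_leq_size.
    by rewrite take_uniq // lengths_uniq.
  move=> x xs; rewrite mem_iota add1n ltnS.
  have := mem_take xs; rewrite mem_lengths => /andP [/andP [-> _] h] /=.
  apply: leq_trans (le _ xs); rewrite /span leq_pmulr //.
  by move: h; rewrite muln_gt0 => /andP [].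
apply: (@leq_trans (i.+1 * s)); last by rewrite expnS expn1 leq_mul2r card orbT.
rewrite -{2}sz -map_take.
elim: (take _ _) le => //= x t IH le.
rewrite mulSn leq_add ?le ?mem_head // IH // => y yt.
by rewrite le // inE yt orbT.
Qed.

(** x lies before the end of its group, and that end is the sum of the spans up to it. *)
Lemma span_sqr_gt (T : finType) (p : {perm T}) (x : nat) : x < #|T| ->
  x < span p (group_length p x) ^ 2.
Proof.
move=> lt; have gl := group_index_lt p lt.
apply: leq_trans (sumn_take_spans gl); apply: leq_trans (group_bound p lt) _.
by rewrite (take_nth 0) ?size_map // sumn_rcons (nth_map 0).
Qed.

Lemma group_index_homo (T : finType) (p : {perm T}) (x y : nat) :
  x <= y -> group_index p x <= group_index p y.
Proof.
rewrite (reshape_leq (spans p)) => /orP [/ltnW //|/andP [/eqP E _]].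
by rewrite /group_index E.
Qed.

Lemma sumn_take_homo (s : seq nat) (i j : nat) :
  i <= j -> sumn (take i s) <= sumn (take j s).
Proof.
move=> ij; rewrite -(cat_take_drop i (take j s)) take_takel //.
by rewrite sumn_cat leq_addr.
Qed.

(** Otherwise a whole group lies between those of y and z. Its span is at least that of the group of
    y, which is at least r by [span_sqr_gt], so z would be at least y + r. *)
Lemma group_index_adjacent (T : finType) (p : {perm T}) (y z r : nat) :
  y <= z -> z < #|T| -> z < y + r -> r ^ 2 <= y.+1 ->
  group_index p z <= (group_index p y).+1.
Proof.
move=> yz zT zr ry; rewrite leqNgt; apply/negP => lt.
have yT := leq_ltn_trans yz zT.
have g2 := ltn_trans lt (group_index_lt p zT).
have := group_start_leq p z; apply/negP; rewrite -ltnNge.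
apply: leq_trans (sumn_take_homo _ lt).
rewrite (take_nth 0) ?size_map // sumn_rcons (nth_map 0) //.
have gyE : sumn (take (group_index p y).+1 (spans p)) =
    group_start p y + span p (group_length p y).
  rewrite (take_nth 0) ?size_map ?group_index_lt // sumn_rcons.
  by rewrite (nth_map 0) ?group_index_lt.
rewrite gyE.
have h1 := group_bound p yT.
have h2 := span_monotone (leqnSn (group_index p y)) g2.
have h3 := span_sqr_gt p yT.
have h4 : r <= span p (group_length p y).
  by rewrite -(@leq_exp2r _ _ 2) //; apply: leq_trans ry h3.
by move: h1 h2 h4; rewrite -/(group_length p y); lia.
Qed.

(** By monotonicity the group of x lies between those of y and z, which are equal or adjacent;
    comparing x with the start of the later one decides. *)
Lemma group_two_candidates (T : finType) (p : {perm T}) (x y z r : nat) :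
  y <= x -> x <= z -> z < #|T| -> z < y + r -> r ^ 2 <= y.+1 ->
  group_index p x = if x < group_start p z then group_index p y
                    else group_index p z.
Proof.
move=> yx xz zT zr ry.
have adj := group_index_adjacent p (leq_trans yx xz) zT zr ry.
have := group_index_homo p yx; have := group_index_homo p xz.
case: ltnP => h; last first.
  move=> le _; apply/eqP; rewrite eqn_leq le /= leqNgt; apply/negP => lt.
  have := group_bound p (leq_ltn_trans xz zT); apply/negP; rewrite -leqNgt.
  apply: leq_trans h; apply: leq_trans (sumn_take_homo _ lt).
  have gl := group_index_lt p (leq_ltn_trans xz zT).
  by rewrite (take_nth 0) ?size_map // sumn_rcons (nth_map 0).
suff : group_index p x != group_index p z by lia.
apply: contraTneq h => E; rewrite -leqNgt.
by have := group_start_leq p x; rewrite /group_start E.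
Qed.

Lemma group_end_leq (T : finType) (p : {perm T}) (x : nat) : x < #|T| ->
  group_start p x + span p (group_length p x) <= #|T|.
Proof.
move=> lt; have gl := group_index_lt p lt.
have -> : group_start p x + span p (group_length p x) =
    sumn (take (group_index p x).+1 (spans p)).
  by rewrite (take_nth 0) ?size_map // sumn_rcons (nth_map 0).
rewrite -(sumn_spans p).
rewrite -[in leqRHS](cat_take_drop (group_index p x).+1 (spans p)).
by rewrite sumn_cat leq_addr.
Qed.

(** * Powers as rotations of positions *)

Lemma layout_perm_inj (n : nat) (p : 'S_n) :
  injective (fun i : 'I_n => nth i (cycle_layout p) i).
Proof.
move=> i j.
(* The default value of [nth] varies with the argument and is made common before uniqueness
   applies. *)
rewrite (set_nth_default i j) ?size_cycle_layout ?card_ord // => /eqP.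
rewrite nth_uniq ?cycle_layout_uniq ?size_cycle_layout ?card_ord // => /eqP.
exact: val_inj.
Qed.

(** The permutation psi, which is stored by the given representation in place of [p]. *)
Definition layout_perm (n : nat) (p : 'S_n) : 'S_n :=
  perm (@layout_perm_inj n p).

Lemma layout_permE (n : nat) (p : 'S_n) (z : 'I_n) (i : 'I_n) :
  layout_perm p i = nth z (cycle_layout p) i.
Proof.
by rewrite permE; apply: set_nth_default; rewrite size_cycle_layout card_ord.
Qed.

(* [kk] is minus the rotation amount modulo [l], so that no intermediate value
   exceeds the larger of [x] and [l]. *)
Definition rotate_position (s l x k : nat) (neg : bool) : nat :=
  let off := (x - s) %% l in
  let kk := if neg then k %% l else l - k %% l in
  x - off + (if off < kk then off + (l - kk) else off - kk).

Lemma iter_period (T : Type) (f : T -> T) (z : T) (l m : nat) :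
  iter l f z = z -> iter m f z = iter (m %% l) f z.
Proof.
move=> fz; rewrite {1}(divn_eq m l) addnC iterD; congr (iter _ f _).
by elim: (m %/ l) => // q IH; rewrite mulSn iterD IH.
Qed.

(** For negative k the inverse power is moved to the other side, hence the congruence for
    [c + absz k], which avoids subtraction. *)
Lemma perm_expz_iter (n : nat) (p : 'S_n) (z : 'I_n) (l b c : nat) (k : int) :
  iter l p z = z ->
  (if (k < 0)%R then c + absz k = b %[mod l] else c = b + absz k %[mod l]) ->
  perm_expz p k (iter b p z) = iter c p z.
Proof.
move=> pz; case: k => k /=.
  rewrite permX -iterD addnC => E.
  by rewrite (iter_period _ pz) -E -(iter_period _ pz).
move=> E; rewrite expgVn; apply: (canLR (permK _)).
by rewrite permX -iterD addnC (iter_period _ pz) -E -(iter_period _ pz).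
Qed.

(** The step back by [kk] wraps around by adding l. For nonnegative exponents [kk] can be l itself,
    and the wrapping branch then returns b. *)
Lemma rotate_modE (l b k : nat) (neg : bool) : 0 < l -> b < l ->
  let kk := if neg then k %% l else l - k %% l in
  let c := if b < kk then b + (l - kk) else b - kk in
  c < l /\ (if neg then c + k = b %[mod l] else c = b + k %[mod l]).
Proof.
move=> l0 bl /=; move: (ltn_pmod k l0) (divn_eq k l).
move: (k %% l) (k %/ l) => r q rl ->.
case: neg.
  have [lt|ge] := ltnP b r; first split; first by lia.
    have -> : b + (l - r) + (q * l + r) = q.+1 * l + b by lia.
    by rewrite modnMDl.
  split; first by lia.
  by have -> : b - r + (q * l + r) = q * l + b by [lia]; rewrite modnMDl.
have [lt|ge] := ltnP b (l - r); first split; first by lia.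
  have -> : b + (q * l + r) = q * l + (b + (l - (l - r))) by lia.
  by rewrite modnMDl.
split; first by lia.
have -> : b + (q * l + r) = q.+1 * l + (b - (l - r)) by lia.
by rewrite modnMDl.
Qed.

(** With a the index of the cycle in its group, x = s + a l + b and y = s + a l + c, so both
    positions read iterates of the same first element z, and the exponents b and c differ by k
    modulo l. *)
Lemma layout_perm_power (n : nat) (p : 'S_n) (x : 'I_n) (k : int) :
  let y := rotate_position (group_start p x) (group_length p x) x (absz k)
             (k < 0)%R in
  exists2 j : 'I_n, j = y :> nat &
    perm_expz p k (layout_perm p x) = layout_perm p j.
Proof.
set s := group_start p x; set l := group_length p x; move=> y.
have xT : (x < #|'I_n|)%N by rewrite card_ord.
have l0 : 0 < l := group_length_gt0 p xT.
have sx : s <= x := group_start_leq p x.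
have [z [pz Ez]] := nth_cycle_layout p x xT.
set a := (x - s) %/ l in Ez; set b := (x - s) %% l.
have bl : b < l by rewrite ltn_mod.
have xE : x = s + (a * l + b) :> nat by rewrite -divn_eq subnKC.
have [cl cE] := rotate_modE (absz k) (k < 0)%R l0 bl.
move: cl cE; set c := (if b < _ then _ else _) => cl cE.
have yE : y = s + (a * l + c).
  by rewrite /y /rotate_position -/b -/c {1}xE addnA addnK addnA.
(* y stays in the same cycle as x, hence before the end of the group. *)
have yn : y < n.
  rewrite -[n]card_ord; apply: leq_trans (group_end_leq p xT).
  rewrite yE ltn_add2l -/l /span; have := group_bound p xT.
  rewrite -/s -/l [x in x < _]xE ltn_add2l /span mulnC => h.
  have : a < size (porbits_of_size p l).
    by rewrite ltnNge; apply/negP => h'; nia.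
  by nia.
exists (Ordinal yn) => //.
rewrite !(layout_permE p x) xE Ez //= yE Ez //.
exact: perm_expz_iter pz cE.
Qed.

(** * Buckets of positions *)

Definition isqrt (n : nat) : nat := Nat.sqrt n.

Lemma isqrt_sqr_leq (n : nat) : isqrt n ^ 2 <= n.
Proof.
have := PeanoNat.Nat.sqrt_spec n (PeanoNat.Nat.le_0_l n).
by rewrite /isqrt; nia.
Qed.

Lemma isqrt_sqr_gt (n : nat) : n < (isqrt n).+1 ^ 2.
Proof.
have := PeanoNat.Nat.sqrt_spec n (PeanoNat.Nat.le_0_l n).
by rewrite /isqrt; nia.
Qed.

Lemma isqrt_gt0 (n : nat) : 0 < n -> 0 < isqrt n.
Proof. by have := isqrt_sqr_gt n; case: (isqrt n) => //; lia. Qed.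

(* Block j is [j * isqrt n, (j + 1) * isqrt n); it is cut into buckets of width
   about the square root of its first position.  This depends on n only, and
   sums to O(sqrt n) buckets. *)
Definition bucket_width (n j : nat) : nat := maxn 1 (isqrt (j * isqrt n)).

(** For positive n this is [isqrt n] over the width, rounded up. *)
Definition bucket_count (n j : nat) : nat :=
  ((isqrt n).-1 %/ bucket_width n j).+1.

Definition bucket_offset (n j : nat) : nat := \sum_(i < j) bucket_count n i.

Definition bucket (n x : nat) : nat :=
  bucket_offset n (x %/ isqrt n) +
  x %% isqrt n %/ bucket_width n (x %/ isqrt n).

Definition block_total (n : nat) : nat := (n %/ isqrt n).+1.

Definition bucket_total (n : nat) : nat := bucket_offset n (block_total n).

(** With h = [isqrt n], n is at most h^2 + 2h = h (h + 2). *)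
Lemma block_total_leq (n : nat) : 0 < n -> block_total n <= (isqrt n + 2).+1.
Proof.
move=> n0; rewrite ltnS -ltnS ltn_divLR ?isqrt_gt0 //.
by have := isqrt_sqr_gt n; have := isqrt_gt0 n0; rewrite expnS expn1; nia.
Qed.

Lemma bucket_width_gt0 (n j : nat) : 0 < bucket_width n j.
Proof. by rewrite leq_maxl. Qed.

Lemma bucket_offsetS (n j : nat) :
  bucket_offset n j.+1 = bucket_offset n j + bucket_count n j.
Proof. by rewrite /bucket_offset big_ord_recr. Qed.

Lemma bucket_offset_homo (n i j : nat) :
  i <= j -> bucket_offset n i <= bucket_offset n j.
Proof.
move=> /subnK <-; elim: (j - i) => // d IH; apply: leq_trans IH _.
by rewrite addSn bucket_offsetS leq_addr.
Qed.

Lemma bucket_lt_offset (n x : nat) : 0 < n ->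
  bucket n x < bucket_offset n (x %/ isqrt n).+1.
Proof.
move=> n0; rewrite bucket_offsetS ltn_add2l ltnS; apply: leq_div2r.
have h := isqrt_gt0 n0; have := ltn_pmod x h; lia.
Qed.

Lemma bucket_lt_total (n x : nat) : x < n -> bucket n x < bucket_total n.
Proof.
move=> xn; apply: leq_trans (bucket_lt_offset _ _) _; first by lia.
by apply: bucket_offset_homo; rewrite ltnS leq_div2r // ltnW.
Qed.

Lemma bucket_offset_leq (n j : nat) : 0 < n -> bucket_offset n j <= j * isqrt n.
Proof.
move=> n0; elim: j => [|j IH]; first by rewrite /bucket_offset big_ord0.
rewrite bucket_offsetS mulSn addnC leq_add //.
have := leq_div (isqrt n).-1 (bucket_width n j); have := isqrt_gt0 n0.
by rewrite /bucket_count; lia.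
Qed.

(** Bucket numbers are computed by the query and must fit in a word. *)
Lemma bucket_leq (n x : nat) : 0 < n -> bucket n x <= x.
Proof.
move=> n0; rewrite [leqRHS](divn_eq x (isqrt n)) leq_add ?bucket_offset_leq //.
exact: leq_div.
Qed.

(** Positions of one bucket share their block, and their offsets in it have the same quotient by the
    width. *)
Lemma bucket_close (n y z : nat) : 0 < n -> bucket n y = bucket n z ->
  z < y + bucket_width n (y %/ isqrt n).
Proof.
move=> n0 E; have h0 := isqrt_gt0 n0.
have eqb : y %/ isqrt n = z %/ isqrt n.
  (* A later block starts at or after the end of the bucket numbers of an earlier one. *)
  have aux u v : bucket n u = bucket n v -> v %/ isqrt n <= u %/ isqrt n.
    move=> Euv; rewrite leqNgt; apply/negP => /(bucket_offset_homo n) le.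
    have := bucket_lt_offset u n0; rewrite Euv => /leq_trans /(_ le).
    by rewrite ltnNge leq_addr.
  by apply/eqP; rewrite eqn_leq !aux.
move/eqP: E; rewrite /bucket -eqb eqn_add2l => /eqP.
have := divn_eq y (isqrt n); have := divn_eq z (isqrt n); rewrite -eqb.
move: (bucket_width_gt0 n (y %/ isqrt n)) (y %% isqrt n) (z %% isqrt n).
move: (bucket_width _ _) (_ * isqrt n) => W c W0 u v zE yE E.
have := divn_eq u W; have := divn_eq v W; have := ltn_pmod v W0.
by rewrite E; move: (v %/ W * W) (u %% W) (v %% W) => d e f; lia.
Qed.

(** The width comes from the first position of the block, which is at most y. The successor accounts
    for width 1 at y = 0. *)
Lemma bucket_width_sqr (n y : nat) : bucket_width n (y %/ isqrt n) ^ 2 <= y.+1.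
Proof.
rewrite /bucket_width /maxn; case: ifP => // _.
apply: leq_trans (isqrt_sqr_leq _) _.
exact: leqW (leq_divM _ _).
Qed.

(** A bucket may contain no position below n. The value is then n here and 0 in [bucket_last]; such
    buckets are never looked up. *)
Definition bucket_first (n b : nat) : nat :=
  find (fun x => bucket n x == b) (iota 0 n).

Definition bucket_last (n b : nat) : nat := \max_(x < n | bucket n x == b) x.

Lemma bucket_firstP (n x : nat) : x < n ->
  bucket_first n (bucket n x) <= x /\
  bucket n (bucket_first n (bucket n x)) = bucket n x.
Proof.
move=> xn; set P := fun y => bucket n y == bucket n x.
have hasP : has P (iota 0 n).
  by apply/hasP; exists x; rewrite ?mem_iota ?add0n //= /P eqxx.
have lt : bucket_first n (bucket n x) < n.
  by move: hasP; rewrite has_find size_iota.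
split; last first.
  by apply/eqP; have := nth_find 0 hasP; rewrite nth_iota.
rewrite leqNgt; apply/negP => /(before_find 0).
by rewrite nth_iota // add0n eqxx.
Qed.

Lemma bucket_lastP (n x : nat) : x < n ->
  [/\ x <= bucket_last n (bucket n x), bucket_last n (bucket n x) < n &
    bucket n (bucket_last n (bucket n x)) = bucket n x].
Proof.
move=> xn; have xP : 0 < #|[pred y : 'I_n | bucket n y == bucket n x]|.
  by apply/card_gt0P; exists (Ordinal xn); rewrite inE /=.
have := eq_bigmax_cond (fun y : 'I_n => y : nat) xP.
rewrite -/(bucket_last n (bucket n x)) => -[y + E].
rewrite inE E => /eqP ->; split=> //.
rewrite -E; exact: (@leq_bigmax_cond _
  (fun y : 'I_n => bucket n y == bucket n x) (fun y => y : nat) (Ordinal xn)).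
Qed.


Lemma bucket_group (n : nat) (p : 'S_n) (x : nat) : x < n ->
  let y := bucket_first n (bucket n x) in
  let z := bucket_last n (bucket n x) in
  group_index p x = if x < group_start p z then group_index p y
                    else group_index p z.
Proof.
move=> xn y z.
have [yx yE] := bucket_firstP xn; have [xz zn zE] := bucket_lastP xn.
apply: (@group_two_candidates _ p x y z (bucket_width n (y %/ isqrt n))) => //.
- by rewrite card_ord.
- by apply: bucket_close; [apply: leq_ltn_trans xn | rewrite yE zE].
exact: bucket_width_sqr.
Qed.

(** * Counting the buckets *)

(** For consecutive square roots a and b, 1 / b <= 2 (b - a): as b^2 - a^2 = 1, this is 2ab <= a^2 +
    b^2. *)
Lemma sum_inv_sqrt (R : realType) (m : nat) :
  (\sum_(j < m) (Num.sqrt j.+1%:R)^-1 <= 2 * Num.sqrt m%:R :> R)%R.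
Proof.
elim: m => [|m IH]; first by rewrite big_ord0 mulr_ge0 // sqrtr_ge0.
rewrite big_ord_recr /=.
set a : R := Num.sqrt m%:R in IH *; set b : R := Num.sqrt m.+1%:R.
have b0 : (0 < b)%R by rewrite sqrtr_gt0 ltr0n.
have a0 : (0 <= a)%R by apply: sqrtr_ge0.
have a2 : (a * a = m%:R)%R by rewrite -expr2 sqr_sqrtr // ler0n.
have b2 : (b * b = m.+1%:R)%R by rewrite -expr2 sqr_sqrtr // ler0n.
have ib : (b * b^-1 = 1)%R by rewrite divff // gt_eqF.
apply: (le_trans (lerD IH (lexx _))).
have e1 : (b * b - a * a = 1)%R by rewrite a2 b2 -natr1; lra.
rewrite -(ler_pM2l b0) mulrDr ib; nra.
Qed.

(** Block 0 has at most h buckets and block j + 1 at most 1 + 2 sqrt h / sqrt (j + 1). Over h + 3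
    blocks this gives at most h + (h + 2) + 4 (h + 1), which is at most 12 h. *)
Lemma bucket_total_leq (R : realType) (n : nat) : 0 < n ->
  ((bucket_total n)%:R <= 13 * (isqrt n)%:R :> R)%R.
Proof.
move=> n0; have h0 := isqrt_gt0 n0; set h := isqrt n in h0 *.
apply: (@le_trans _ _ ((bucket_offset n (h + 2).+1)%:R)%R).
  by rewrite ler_nat bucket_offset_homo // block_total_leq.
rewrite /bucket_offset big_ord_recl natrD natr_sum.
have c0 : bucket_count n 0 <= h.
  by rewrite /bucket_count -/h; have := leq_div h.-1 (bucket_width n 0); lia.
have cj j : ((bucket_count n j.+1)%:R <=
    1 + 2 * Num.sqrt h%:R * (Num.sqrt j.+1%:R)^-1 :> R)%R.
  rewrite /bucket_count -natr1 addrC lerD2l; set W := bucket_width n j.+1.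
  have W0 : 0 < W by exact: bucket_width_gt0.
  have hR : (0 < Num.sqrt h%:R :> R)%R by rewrite sqrtr_gt0 ltr0n.
  have jR : (0 < Num.sqrt j.+1%:R :> R)%R by rewrite sqrtr_gt0 ltr0n.
  (* Rounding down in [isqrt] costs a factor 2: (j + 1) h < (W + 1)^2 <= (2 W)^2. *)
  have W2 : (Num.sqrt h%:R * Num.sqrt j.+1%:R <= 2 * W%:R :> R)%R.
    rewrite -sqrtrM ?ler0n // -natrM.
    have -> : (2 * W%:R = Num.sqrt ((2 * W) ^ 2)%:R :> R)%R.
      by rewrite natrX natrM sqrtr_sqr ger0_norm // mulr_ge0 // ler0n.
    rewrite ler_sqrt ?ler_nat ?ler0n //.
    have : isqrt (j.+1 * h) <= W by rewrite leq_maxr.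
    by have := isqrt_sqr_gt (j.+1 * h); move: (isqrt (_ * _)) => q; nia.
  have hh : (Num.sqrt h%:R * Num.sqrt h%:R = h%:R :> R)%R.
    by rewrite -expr2 sqr_sqrtr // ler0n.
  have dW : ((h.-1 %/ W)%:R * W%:R <= h%:R :> R)%R.
    by rewrite -natrM ler_nat; apply: leq_trans (leq_divM _ _) (leq_pred _).
  rewrite -/h ler_pdivlMr //.
  have q0 : (0 <= (h.-1 %/ W)%:R :> R)%R by rewrite ler0n.
  move: hR jR W2 hh dW q0; move: (Num.sqrt h%:R) (Num.sqrt j.+1%:R) => a b.
  move: ((_ %/ _)%:R)%R (h%:R)%R (W%:R)%R => q hr Wr a0 b0 W2 <- dW q0.
  (* Multiplied by a, the claim is q a b <= 2 q W <= 2 h = 2 a^2. *)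
  by rewrite -(ler_pM2l a0); nra.
have S : (\sum_(j < h + 2) (bucket_count n j.+1)%:R <= 
   \sum_(j < h + 2) (1 + 2 * Num.sqrt h%:R * (Num.sqrt j.+1%:R)^-1) :> R)%R.
  by apply: ler_sum => j _; apply: cj.
have := sum_inv_sqrt R (h + 2).
rewrite big_split /= -big_distrr /= sumr_const card_ord in S.
have sq : (Num.sqrt h%:R * Num.sqrt (h + 2)%:R <= h%:R + 1 :> R)%R.
  rewrite -sqrtrM ?ler0n // -natrM natr1.
  have -> : (h.+1%:R = Num.sqrt (h.+1 ^ 2)%:R :> R)%R.
    by rewrite natrX sqrtr_sqr ger0_norm // ler0n.
  by rewrite ler_sqrt ?ler_nat ?ler0n //; nia.
have s0 : (0 <= Num.sqrt h%:R :> R)%R by rewrite sqrtr_ge0.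
have c0' : ((bucket_count n 0)%:R <= h%:R :> R)%R by rewrite ler_nat.
have h1 : (1 <= h%:R :> R)%R by rewrite ler1n.
move: S; set T := (\sum_(_ < _) _^-1)%R => S T2.
have {}S := le_trans S (lerD (lexx _) (ler_wpM2l (mulr_ge0 (ler0n R 2) s0) T2)).
apply: le_trans (lerD c0' S) _.
move: (Num.sqrt (h + 2)%:R)%R sq => c sq.
rewrite natrD; nra.
Qed.

(** * The query program *)

(** Register contents are kept in the form [to_word w v], with v the intended natural number. *)
Lemma to_word_val (w : nat) (a : word w) (v : nat) :
  a = v :> nat -> a = to_word w v.
Proof. by move=> <-; apply: val_inj; rewrite /= modn_small. Qed.

Lemma val_to_word (w v : nat) : v < 2 ^ w -> to_word w v = v :> nat.
Proof. exact: modn_small. Qed.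

Lemma eval_add (w a b : nat) : a < 2 ^ w -> b < 2 ^ w ->
  eval_op OpAdd (to_word w a) (to_word w b) = to_word w (a + b).
Proof.
by move=> ha hb; apply: val_inj; rewrite /= !(modn_small ha, modn_small hb).
Qed.

Lemma eval_sub (w a b : nat) : a < 2 ^ w -> b <= a ->
  eval_op OpSub (to_word w a) (to_word w b) = to_word w (a - b).
Proof.
move=> ha hb; have hb' := leq_ltn_trans hb ha.
apply: val_inj; rewrite /= (modn_small ha) (modn_small hb').
by rewrite addnBA ?(ltnW hb') // addnC -addnBA // modnDl.
Qed.

Lemma eval_div (w a b : nat) : a < 2 ^ w -> b < 2 ^ w ->
  eval_op OpDiv (to_word w a) (to_word w b) = to_word w (a %/ b).
Proof.
by move=> ha hb; apply: val_inj; rewrite /= !(modn_small ha, modn_small hb).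
Qed.

Lemma eval_mod (w a b : nat) : a < 2 ^ w -> b < 2 ^ w ->
  eval_op OpMod (to_word w a) (to_word w b) = to_word w (a %% b).
Proof.
by move=> ha hb; apply: val_inj; rewrite /= !(modn_small ha, modn_small hb).
Qed.

(** Symbolic execution: the rules below each spend one unit of the time t, and [reaches_halt]
    discards the rest, so branches of different lengths share one bound. *)
Definition reaches (w : nat) (P : program) (D : seq bitseq) (t : nat)
    (c : config w) (Post : (nat -> word w) -> (word w -> word w) -> Prop) :
    Prop :=
  exists l g m, [/\ iter t (step P D) c = Config l g m,
    halted P (Config l g m) & Post g m].

Lemma reaches_run (w : nat) (P : program) (D : seq bitseq) (t : nat)
    (g : nat -> word w) (m : word w -> word w)
    (Post : (nat -> word w) -> (word w -> word w) -> Prop) :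
  reaches P D t (Config 0 g m) Post ->
  exists g' m', run P D t g m g' m' /\ Post g' m'.
Proof.
by move=> [l [g' [m' [E h post]]]]; exists g', m'; split=> //; exists l.
Qed.

Lemma reaches_halt (w : nat) (P : program) (D : seq bitseq) (t l : nat)
    (g : nat -> word w) (m : word w -> word w)
    (Post : (nat -> word w) -> (word w -> word w) -> Prop) :
  fetch P l = Halt -> Post g m -> reaches P D t (Config l g m) Post.
Proof.
move=> f post; exists l, g, m.
have h : halted P (Config l g m) by rewrite /halted /= f.
split=> //; have := @iter_step_halted w P D (Config l g m) 0 t h.
by rewrite addn0.
Qed.

Lemma reaches_step (w : nat) (P : program) (D : seq bitseq) (t : nat)
    (c c' : config w) (Post : (nat -> word w) -> (word w -> word w) -> Prop) :
  step P D c = c' -> reaches P D t c' Post -> reaches P D t.+1 c Post.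
Proof. by move=> E [l [g [m H]]]; exists l, g, m; rewrite iterSr E. Qed.

Lemma reaches_binop (w : nat) (P : program) (D : seq bitseq) (t l : nat)
    (o : binop) (r a b : nat) (v : word w)
    (g : nat -> word w) (m : word w -> word w)
    (Post : (nat -> word w) -> (word w -> word w) -> Prop) :
  fetch P l = BinOp o r a b -> eval_op o (g a) (g b) = v ->
  reaches P D t (Config l.+1 (upd g r v) m) Post ->
  reaches P D t.+1 (Config l g m) Post.
Proof. by move=> f E; apply: reaches_step; rewrite /= f E. Qed.

Lemma reaches_read (w : nat) (P : program) (D : seq bitseq) (t l : nat)
    (r j a : nat) (v : word w) (g : nat -> word w) (m : word w -> word w)
    (Post : (nat -> word w) -> (word w -> word w) -> Prop) :
  fetch P l = ReadData r j a -> read_word w (nth [::] D j) (g a) = v ->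
  reaches P D t (Config l.+1 (upd g r v) m) Post ->
  reaches P D t.+1 (Config l g m) Post.
Proof. by move=> f E; apply: reaches_step; rewrite /= f E. Qed.

Lemma reaches_const (w : nat) (P : program) (D : seq bitseq) (t l : nat)
    (r v : nat) (g : nat -> word w) (m : word w -> word w)
    (Post : (nat -> word w) -> (word w -> word w) -> Prop) :
  fetch P l = Const r v ->
  reaches P D t (Config l.+1 (upd g r (to_word w v)) m) Post ->
  reaches P D t.+1 (Config l g m) Post.
Proof. by move=> f; apply: reaches_step; rewrite /= f. Qed.

Lemma reaches_jump (w : nat) (P : program) (D : seq bitseq) (t l l' : nat)
    (g : nat -> word w) (m : word w -> word w)
    (Post : (nat -> word w) -> (word w -> word w) -> Prop) :
  fetch P l = Jump l' -> reaches P D t (Config l' g m) Post ->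
  reaches P D t.+1 (Config l g m) Post.
Proof. by move=> f; apply: reaches_step; rewrite /= f. Qed.

Lemma reaches_jumplt (w : nat) (P : program) (D : seq bitseq) (t l : nat)
    (a b l' : nat) (c : bool) (g : nat -> word w) (m : word w -> word w)
    (Post : (nat -> word w) -> (word w -> word w) -> Prop) :
  fetch P l = JumpLt a b l' -> (g a < g b)%N = c ->
  reaches P D t (Config (if c then l' else l.+1) g m) Post ->
  reaches P D t.+1 (Config l g m) Post.
Proof. by move=> f E; apply: reaches_step; rewrite /= f E. Qed.

Lemma reaches_jumpeq (w : nat) (P : program) (D : seq bitseq) (t l : nat)
    (a b l' : nat) (c : bool) (g : nat -> word w) (m : word w -> word w)
    (Post : (nat -> word w) -> (word w -> word w) -> Prop) :
  fetch P l = JumpEq a b l' -> (g a == g b) = c ->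
  reaches P D t (Config (if c then l' else l.+1) g m) Post ->
  reaches P D t.+1 (Config l g m) Post.
Proof. by move=> f E; apply: reaches_step; rewrite /= f E. Qed.

(* Register 0 holds a position x; the start and the length of the group of x are
   left in registers 1 and 2. *)
Definition lookup_program (J : nat) : program :=
  [:: Const 3 0;
      ReadData 3 J 3;
      BinOp OpDiv 4 0 3;
      BinOp OpMod 5 0 3;
      ReadData 6 J.+1 4;
      ReadData 7 J.+2 4;
      BinOp OpDiv 8 5 6;
      BinOp OpAdd 7 7 8;
      ReadData 1 (J + 5) 7;
      ReadData 2 (J + 6) 7;
      JumpLt 0 1 12;
      Halt;
      ReadData 1 (J + 3) 7;
      ReadData 2 (J + 4) 7].

(** A and B are the two candidates, B being the later group. Only the branch for A takes all 13
    steps: it falls off the end of the program, which counts as [Halt]. *)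
Lemma run_lookup (w : nat) (D : seq bitseq) (J x h r o sA lA sB lB : nat)
    (g : nat -> word w) (m : word w -> word w) (b := o + x %% h %/ r) :
  x < 2 ^ w -> h < 2 ^ w -> r < 2 ^ w -> o < 2 ^ w -> b < 2 ^ w -> sB < 2 ^ w ->
  g 0 = x :> nat ->
  read_word w (nth [::] D J) 0 = to_word w h ->
  read_word w (nth [::] D J.+1) (x %/ h) = to_word w r ->
  read_word w (nth [::] D J.+2) (x %/ h) = to_word w o ->
  read_word w (nth [::] D (J + 3)) b = to_word w sA ->
  read_word w (nth [::] D (J + 4)) b = to_word w lA ->
  read_word w (nth [::] D (J + 5)) b = to_word w sB ->
  read_word w (nth [::] D (J + 6)) b = to_word w lB ->
  exists g' m', run (lookup_program J) D 13 g m g' m' /\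
    [/\ g' 0 = to_word w x,
      g' 1 = to_word w (if x < sB then sA else sB),
      g' 2 = to_word w (if x < sB then lA else lB) &
      forall i, 9 <= i -> g' i = g i].
Proof.
move=> xw hw rw ow bw sBw /to_word_val g0 eh er eo esA elA esB elB.
have divw a c : a < 2 ^ w -> a %/ c < 2 ^ w.
  by apply: leq_ltn_trans; apply: leq_div.
have modw a c : a < 2 ^ w -> a %% c < 2 ^ w.
  by apply: leq_ltn_trans; apply: leq_mod.
apply: (@reaches_run _ _ _ _ _ _ (fun g' _ => [/\ _, _, _ & _])).
apply: reaches_const => //=.
apply: (reaches_read (v := to_word w h)) => //=; first by rewrite mod0n eh.
apply: (reaches_binop (v := to_word w (x %/ h))) => //;
  first by rewrite /= /upd /= g0 eval_div.
apply: (reaches_binop (v := to_word w (x %% h))) => //;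
  first by rewrite /= /upd /= g0 eval_mod.
apply: (reaches_read (v := to_word w r)) => //;
  first by rewrite /= modn_small ?divw // er.
apply: (reaches_read (v := to_word w o)) => //;
  first by rewrite /= modn_small ?divw // eo.
apply: (reaches_binop (v := to_word w (x %% h %/ r))) => //;
  first by rewrite /= /upd /= eval_div ?modw.
apply: (reaches_binop (v := to_word w b)) => //.
  by rewrite /= /upd /= eval_add ?modw ?divw ?modw.
apply: (reaches_read (v := to_word w sB)) => //;
  first by rewrite /= modn_small // esB.
apply: (reaches_read (v := to_word w lB)) => //;
  first by rewrite /= modn_small // elB.
apply: (reaches_jumplt (c := x < sB)) => //.
  by rewrite /= /upd /= g0 /= !modn_small.
case: ltnP => _ /=.
  apply: (reaches_read (v := to_word w sA)) => //;
    first by rewrite /= modn_small // esA.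
  apply: (reaches_read (v := to_word w lA)) => //;
    first by rewrite /= modn_small // elA.
  apply: reaches_halt => //; split=> // i i9.
  by rewrite /upd !gtn_eqF //; apply: leq_trans i9.
apply: reaches_halt => //; split=> // i i9.
by rewrite /upd !gtn_eqF //; apply: leq_trans i9.
Qed.

(* Registers 0 to 4 hold x, s, l, k and the sign in the notation of
   [rotate_position], whose value is left in register 1. *)
Definition rotate_program : program :=
  [:: BinOp OpSub 5 0 1;
      BinOp OpMod 5 5 2;
      BinOp OpSub 6 0 5;
      BinOp OpMod 3 3 2;
      Const 7 0;
      JumpEq 4 7 7;
      Jump 8;
      BinOp OpSub 3 2 3;
      JumpLt 5 3 11;
      BinOp OpSub 5 5 3;
      Jump 13;
      BinOp OpSub 7 2 3;
      BinOp OpAdd 5 5 7;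
      BinOp OpAdd 1 6 5].

Lemma run_rotate (w : nat) (D : seq bitseq) (s l x k : nat) (neg : bool)
    (g : nat -> word w) (m : word w -> word w) :
  x < 2 ^ w -> s <= x -> 0 < l < 2 ^ w -> k < 2 ^ w ->
  rotate_position s l x k neg < 2 ^ w ->
  g 0 = to_word w x -> g 1 = to_word w s -> g 2 = to_word w l ->
  g 3 = k :> nat -> g 4 = neg :> nat ->
  exists g' m', run rotate_program D 12 g m g' m' /\
    [/\ g' 1 = to_word w (rotate_position s l x k neg) &
      forall i, 9 <= i -> g' i = g i].
Proof.
move=> xw sx /andP [l0 lw] kw; rewrite /rotate_position.
set b := (x - s) %% l => yw g0 g1 g2 /to_word_val g3 /to_word_val g4.
have bl : b < l by rewrite ltn_mod.
have bw := ltn_trans bl lw.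
have bx : b <= x by apply: leq_trans (leq_mod _ _) (leq_subr _ _).
have rl : k %% l < l by rewrite ltn_mod.
have rw := ltn_trans rl lw.
set kk := if neg then k %% l else l - k %% l in yw *.
have kl : kk <= l by rewrite /kk; case: (neg); lia.
have kkw := leq_ltn_trans kl lw.
have xbw : x - b < 2 ^ w by apply: leq_ltn_trans xw; apply: leq_subr.
have xsw : x - s < 2 ^ w by apply: leq_ltn_trans xw; apply: leq_subr.
(* A positive l below [2 ^ w] leaves room for the value 1. *)
have w2 : (neg : nat) < 2 ^ w.
  apply: leq_ltn_trans (leq_trans (_ : 1 < l.+1) lw); rewrite ?ltnS //.
  by case: (neg).
apply: (@reaches_run _ _ _ _ _ _ (fun g' _ => [/\ _ & _])).
apply: (reaches_binop (v := to_word w (x - s))) => //;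
  first by rewrite g0 g1 eval_sub.
apply: (reaches_binop (v := to_word w b)) => //;
  first by rewrite /= /upd /= g2 eval_mod.
apply: (reaches_binop (v := to_word w (x - b))) => //;
  first by rewrite /= /upd /= g0 eval_sub.
apply: (reaches_binop (v := to_word w (k %% l))) => //;
  first by rewrite /= /upd /= g3 g2 eval_mod.
apply: reaches_const => //=.
apply: (reaches_jumpeq (c := ~~ neg)) => //.
  by rewrite /= /upd /= g4 -val_eqE /= mod0n modn_small //; case: (neg).
(* Both signs meet at instruction 8, with [kk] in register 3; the rest is executed once for both. *)
have tail t g1' :
    g1' 5 = to_word w b -> g1' 3 = to_word w kk -> g1' 2 = to_word w l ->
    g1' 6 = to_word w (x - b) -> (forall i, 9 <= i -> g1' i = g i) ->
  reaches rotate_program D (t + 5) (Config 8 g1' m) (fun g' _ =>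
    g' 1 = to_word w (x - b + (if b < kk then b + (l - kk) else b - kk)) /\
    (forall i, 9 <= i -> g' i = g i)).
  move=> h5 h3 h2 h6 fr; rewrite !addnS addn0.
  apply: (reaches_jumplt (c := b < kk)) => //.
    by rewrite h5 h3 /= !modn_small.
  case: (ltnP b kk) yw => [lt|ge] yw /=.
    apply: (reaches_binop (v := to_word w (l - kk))) => //;
      first by rewrite h2 h3 eval_sub.
    apply: (reaches_binop (v := to_word w (b + (l - kk)))) => //.
      by rewrite /= /upd /= h5 eval_add //; lia.
    apply: (reaches_binop (v := to_word w (x - b + (b + (l - kk))))) => //.
      by rewrite /= /upd /= h6 eval_add //; lia.
    apply: reaches_halt => //; split=> // i i9.
    by rewrite /upd !gtn_eqF ?fr //; apply: leq_trans i9.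
  apply: (reaches_binop (v := to_word w (b - kk))) => //;
    first by rewrite h5 h3 eval_sub.
  apply: reaches_jump => //=.
  apply: (reaches_binop (v := to_word w (x - b + (b - kk)))) => //.
    by rewrite /= /upd /= h6 eval_add //; lia.
  apply: reaches_halt => //; split=> // i i9.
  by rewrite /upd !gtn_eqF ?fr //; apply: leq_trans i9.
move: tail; rewrite /kk; case: (neg) => /= tail.
  apply: reaches_jump => //=; apply: (tail 0) => // i i9.
  by rewrite /upd !gtn_eqF //; apply: leq_trans i9.
apply: (reaches_binop (v := to_word w (l - k %% l))) => //.
  by rewrite /= /upd /= g2 eval_sub // ltnW.
apply: (tail 0) => // i i9.
by rewrite /upd !gtn_eqF //; apply: leq_trans i9.
Qed.

(** n, the absolute value of k and its sign are saved from register [K] on. [Pi] turns i into its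
    position, lookup and rotation move that position, and [Pf] reads the element there. *)
Definition power_program (K J : nat) (Pf Pi : program) : program :=
  seqp [:: Move K 0; Move K.+1 2; Move K.+2 3]
  (seqp Pi
  (seqp (lookup_program J)
  (seqp [:: Move 3 K.+1; Move 4 K.+2]
  (seqp rotate_program
  (seqp [:: Move 0 K]
  Pf))))).

(** In the order that [lookup_program] expects from array [J] on: the block size, two tables indexed
    by blocks, and the two candidate groups of each bucket. *)
Definition group_arrays (w n : nat) (p : 'S_n) : seq bitseq :=
  [:: pack w (fun=> isqrt n) 1;
      pack w (bucket_width n) (block_total n);
      pack w (bucket_offset n) (block_total n);
      pack w (fun b => group_start p (bucket_first n b)) (bucket_total n);
      pack w (fun b => group_length p (bucket_first n b)) (bucket_total n);
      pack w (fun b => group_start p (bucket_last n b)) (bucket_total n);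
      pack w (fun b => group_length p (bucket_last n b)) (bucket_total n)].

(** [D0] is the structure that the given programs were made for, [D] the one extended by the group
    tables. *)
Lemma power_program_computes (w n K J tf ti : nat) (Pf Pi : program)
    (D0 D : seq bitseq) (p : 'S_n) (i : 'I_n) (k : int) (q := layout_perm p) :
  n < 2 ^ w -> absz k <= n -> 9 <= K -> reg_bound Pi <= K ->
  (forall j, j < array_bound Pf -> nth [::] D0 j = nth [::] D j) ->
  (forall j, j < array_bound Pi -> nth [::] D0 j = nth [::] D j) ->
  (forall j, nth [::] D (J + j) = nth [::] (group_arrays w p) j) ->
  (forall j : 'I_n, computes w Pf D0 [:: n; val j] (q j) tf) ->
  (forall j : 'I_n, computes w Pi D0 [:: n; val j] (q^-1 j)%g ti) ->
  computes w (power_program K J Pf Pi) D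
    [:: n; val i; absz k; nat_of_bool (k < 0)%R] (perm_expz p k i)
    (tf + ti + 37).
Proof.
move=> nw kn K9 KPi Df Di Dg hf hi; apply: run_computes => g m args.
have a0 : g 0 = n :> nat by rewrite (args 0).
have a1 : g 1 = i :> nat by rewrite (args 1).
have a2 : g 2 = absz k :> nat by rewrite (args 2).
have a3 : g 3 = (k < 0)%R :> nat by rewrite (args 3).
pose x := (q^-1 i)%g.
have Ei : i = q x by rewrite permKV.
have [y0 yE Ey] := layout_perm_power p x k.
rewrite -/q -Ei in Ey.
have n0 : 0 < n by apply: leq_ltn_trans (ltn_ord i).
have xn := ltn_ord x.
have xT : (x < #|'I_n|)%N by rewrite card_ord.
have le_w v : v <= n -> v < 2 ^ w by move=> h; apply: leq_ltn_trans nw.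
have [yx _] := bucket_firstP xn; have [_ zn _] := bucket_lastP xn.
have Kne c : c < 9 ->
    (K == c = false) * (K.+1 == c = false) * (K.+2 == c = false).
  by move=> c9; do !split; apply/eqP; lia.
pose g1 := upd (upd (upd g K (g 0)) K.+1 (g 2)) K.+2 (g 3).
have R1 : run [:: Move K 0; Move K.+1 2; Move K.+2 3] D 3 g m g1 m.
  exists 3; rewrite /= /g1 /upd !(eq_sym _ K) !(eq_sym _ K.+1).
  by rewrite !Kne.
have g1_frame c : c < 9 -> g1 c = g c.
  by move=> c9; rewrite /g1 /upd !(eq_sym c) !Kne.
have [|g2 [m2 [R2 g20]]] := @computes_run _ _ _ _ _ _ g1 m (hi i).
  by move=> [|[|]] //= _; rewrite g1_frame.
have {}R2 := run_eq_data Di R2.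
have g2K c : g2 (K + c) = g1 (K + c).
  by rewrite (run_frame R2) //; apply: leq_trans KPi (leq_addr _ _).
(* Every number handled by the lookup is at most n, hence fits in a word. *)
have hsq : isqrt n <= n by have := isqrt_sqr_leq n; rewrite expnS expn1; nia.
have bx : x %/ isqrt n < block_total n by rewrite ltnS leq_div2r // ltnW.
have bT : bucket n x < bucket_total n by apply: bucket_lt_total.
have bX : bucket n x <= x by apply: bucket_leq.
have wn : bucket_width n (x %/ isqrt n) <= n.
  by have := bucket_width_sqr n x; rewrite expnS expn1; nia.
have on : bucket_offset n (x %/ isqrt n) <= n.
  by apply: leq_trans (leq_trans bX (ltnW xn)); rewrite leq_addr.
have Dj j f N a : nth [::] (group_arrays w p) j = pack w f N -> a < N ->
    read_word w (nth [::] D (J + j)) a = to_word w (f a).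
  by rewrite Dg => -> aN; rewrite read_pack.
have D0' := @Dj 0 _ _ _ erefl (ltn0Sn 0); rewrite addn0 in D0'.
have D1' := @Dj 1 _ _ _ erefl bx; rewrite addn1 in D1'.
have D2' := @Dj 2 _ _ _ erefl bx; rewrite addn2 in D2'.
have [g3 [m3 [R3 [g30 g31 g32 g3_frame]]]] :=
  run_lookup m2 (le_w _ (ltnW xn)) (le_w _ hsq) (le_w _ wn) (le_w _ on)
    (le_w _ (leq_trans bX (ltnW xn)))
    (le_w _ (leq_trans (group_start_leq p _) (ltnW zn)))
    g20 D0' D1' D2' (@Dj 3 _ _ _ erefl bT) (@Dj 4 _ _ _ erefl bT)
    (@Dj 5 _ _ _ erefl bT) (@Dj 6 _ _ _ erefl bT).
(* The comparison made by the program is the one in [bucket_group], so registers 1 and 2 describe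
   the group of x. *)
have gx := bucket_group p xn; rewrite /= in gx.
have {}g31 : g3 1 = to_word w (group_start p x).
  by rewrite g31 [in RHS]/group_start gx; case: ifP.
have {}g32 : g3 2 = to_word w (group_length p x).
  by rewrite g32 [in RHS]/group_length gx; case: ifP.
pose g4 := upd (upd g3 3 (g3 K.+1)) 4 (g3 K.+2).
have R4 : run [:: Move 3 K.+1; Move 4 K.+2] D 2 g3 m3 g4 m3.
  by exists 2; rewrite /= /g4 /upd Kne.
have gK c : c < 3 -> g3 (K + c) = g1 (K + c).
  by move=> _; rewrite -g2K g3_frame //; apply: leq_trans K9 (leq_addr _ _).
have K0 : g3 K = g 0.
  by rewrite -[K]addn0 gK // addn0 /g1 /upd eqxx !ltn_eqF.
have K1 : g3 K.+1 = g 2.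
  by rewrite -[K.+1]addn1 gK // addn1 /g1 /upd eqxx !ltn_eqF.
have K2 : g3 K.+2 = g 3 by rewrite -[K.+2]addn2 gK // addn2 /g1 /upd eqxx.
have l0 := group_length_gt0 p xT.
have ln := group_length_leq p xT; rewrite card_ord in ln.
have [g5 [m5 [R5 [g51 g5_frame]]]] : exists g' m',
    run rotate_program D 12 g4 m3 g' m' /\
    [/\ g' 1 = to_word w (rotate_position (group_start p x) (group_length p x) x
          (absz k) (k < 0)%R) &
      forall i, 9 <= i -> g' i = g4 i].
  apply: run_rotate; rewrite ?group_start_leq ?l0 //=; try exact: le_w.
  - by apply: le_w; apply: ltnW.
  - by rewrite -yE; apply: le_w; apply: ltnW.
  - by rewrite /g4 /upd /= K1.
  by rewrite /g4 /upd /= K2.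
pose g6 := upd g5 0 (g5 K).
have R6 : run [:: Move 0 K] D 1 g5 m5 g6 m5 by exists 1.
have [|g7 [m7 [R7 g70]]] := @computes_run _ _ _ _ _ _ g6 m5 (hf y0).
  move=> [|[|]] //= _.
    rewrite /g6 /upd /= g5_frame // /g4 /upd !Kne // K0; exact: a0.
  rewrite /g6 /upd /= g51 val_to_word -yE //.
  by apply: le_w; apply: ltnW.
have {}R7 := run_eq_data Df R7.
exists g7, m7; split; last by rewrite g70 Ey.
(* The fixed stages take 3 + 13 + 2 + 12 + 1 steps and the six compositions one each, 37 in all. *)
have R := run_seqp R1 (run_seqp R2 (run_seqp R3 (run_seqp R4 (run_seqp R5
  (run_seqp R6 R7))))).
by apply: run_leq R; lia.
Qed.

(** * Asymptotics *)

Lemma lg_geq (R : realType) (k : nat) (x : R) : (2 ^+ k <= x -> k%:R <= lg x)%R.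
Proof.
move=> kx; have ln2 : (0 < ln 2 :> R)%R by rewrite ln_gt0 // ltr1n.
rewrite /lg ler_pdivlMr // mulr_natl -lnXn // ler_ln ?posrE ?exprn_gt0 //.
by apply: lt_le_trans kx; rewrite exprn_gt0.
Qed.

(** ln y <= y is used twice, for y = lg x and for y = sqrt x, the latter through ln x = 2 ln (sqrt
    x). *)
Lemma lglg_leq_sqrt (R : realType) (x : R) : (4 <= x)%R ->
  (lg (lg x) <= 2 / ln 2 ^+ 2 * Num.sqrt x)%R.
Proof.
move=> x4; have ln2 : (0 < ln 2 :> R)%R by rewrite ln_gt0 // ltr1n.
have x0 : (0 < x)%R by apply: lt_le_trans x4.
have s0 : (0 < Num.sqrt x)%R by rewrite sqrtr_gt0.
have L0 : (0 < lg x)%R.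
  by apply: (@lt_le_trans _ _ 2%:R)%R; rewrite ?ltr0n // lg_geq // expr2 -natrM.
have lnx : (ln x <= 2 * Num.sqrt x)%R.
  rewrite -{1}(sqr_sqrtr (ltW x0)) lnXn // -[leLHS]mulr_natl ler_pM2l //.
  exact: ltW (ln_sublinear s0).
have h1 : (lg (lg x) <= lg x / ln 2)%R.
  by rewrite {1}/lg ler_pM2r ?invr_gt0 // ltW // ln_sublinear.
apply: (le_trans h1); rewrite /lg expr2 invfM mulrA mulrAC [leRHS]mulrAC.
by rewrite ler_pM2r ?invr_gt0 // mulrAC ler_pM2r ?invr_gt0.
Qed.

(** The first space bound follows from the second, as lg lg n is O(sqrt n). *)
Lemma bigO_lglg_div (R : realType) (f : nat -> R^o) :
  (f =O_\oo (fun n => Num.sqrt n%:R * lg n%:R : R^o))%R ->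
  (f =O_\oo (fun n => n%:R * lg n%:R / lg (lg n%:R) : R^o))%R.
Proof.
move=> /eqO_exP [k k0 H]; apply/eqO_exP.
have ln2 : (0 < ln 2 :> R)%R by rewrite ln_gt0 // ltr1n.
exists (k * (2 / ln 2 ^+ 2))%R.
  by rewrite mulr_gt0 // divr_gt0 // exprn_gt0.
near=> n; have n4 : (4 <= n%:R :> R)%R.
  by rewrite ler_nat; near: n; apply: nbhs_infty_ge.
have fn : (`|f n| <= k * `|Num.sqrt n%:R * lg n%:R : R^o|)%R.
  by near: n; exact: H.
apply: (le_trans fn); rewrite -[leRHS]mulrA ler_pM2l //.
have L2 : (2 <= lg (n%:R : R))%R.
  by apply: (@lg_geq R 2); rewrite expr2 -natrM.
have M1 : (1 <= lg (lg (n%:R : R)))%R.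
  by apply: (@lg_geq R 1); rewrite expr1.
have L0 : (0 < lg (n%:R : R))%R by apply: lt_le_trans L2.
have M0 : (0 < lg (lg (n%:R : R)))%R by apply: lt_le_trans M1.
have s0 : (0 <= Num.sqrt (n%:R : R))%R by apply: sqrtr_ge0.
rewrite (ger0_norm (mulr_ge0 s0 (ltW L0))).
rewrite (ger0_norm (divr_ge0 (mulr_ge0 (ler0n R n) (ltW L0)) (ltW M0))).
rewrite [leRHS]mulrA ler_pdivlMr //.
have swap (c a b x : R) : (x = a ^+ 2 -> c * (x * b) = a * b * (c * a))%R.
  by move=> ->; ring.
rewrite (swap _ _ _ _ (esym (sqr_sqrtr (ler0n R n)))).
by rewrite (ler_wpM2l (mulr_ge0 s0 (ltW L0))) ?lglg_leq_sqrt.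
Unshelve. all: by end_near. Qed.

Lemma bigO_const_lglg (R : realType) (c : nat) :
  ((fun=> c%:R : R^o) =O_\oo (fun n : nat => lg (lg n%:R) : R^o))%R.
Proof.
apply/eqO_exP; exists (c.+1%:R)%R; first by rewrite ltr0n.
near=> n; have n4 : (4 <= n%:R :> R)%R.
  by rewrite ler_nat; near: n; apply: nbhs_infty_ge.
have L2 : (2 <= lg (n%:R : R))%R.
  by apply: (@lg_geq R 2); rewrite expr2 -natrM.
have M1 : (1 <= lg (lg (n%:R : R)))%R.
  by apply: (@lg_geq R 1); rewrite expr1.
have M0 : (0 < lg (lg (n%:R : R)))%R by apply: lt_le_trans M1.
rewrite ger0_norm ?ler0n // ger0_norm ?(ltW M0) //.
rewrite -[leLHS]mulr1; apply: ler_pM => //; by rewrite ler_nat.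
Unshelve. all: by end_near. Qed.

Lemma bigO_const_1 (R : realType) (c : nat) :
  ((fun=> c%:R : R^o) =O_\oo (fun _ : nat => 1 : R^o))%R.
Proof.
apply/eqO_exP; exists (c.+1%:R)%R; first by rewrite ltr0n.
by near=> n; rewrite normr1 mulr1 ger0_norm ?ler0n // ler_nat.
Unshelve. all: by end_near. Qed.

Definition extra_bits (w : nat -> nat) (n : nat) : nat :=
  w n * (1 + 2 * block_total n + 4 * bucket_total n).

Lemma extra_bits_bigO (R : realType) (w : nat -> nat) : word_size R w ->
  ((fun n => (extra_bits w n)%:R : R^o) =O_\oo
     (fun n => Num.sqrt n%:R * lg n%:R : R^o))%R.
Proof.
case=> _ hw.
have /eqO_exP [k k0 H] :
    ((fun n => (w n)%:R : R^o) =O_\oo (fun n => lg n%:R : R^o))%R.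
  by rewrite hw; apply: eqThetaO.
(* With h = [isqrt n] >= 1, 1 + 2 (h + 3) + 4 * 13 h = 54 h + 7 <= 61 h. *)
apply/eqO_exP; exists (k * 61)%R; first by rewrite mulr_gt0.
near=> n; have n1 : 0 < n by near: n; apply: nbhs_infty_gt.
have wn : (`|(w n)%:R : R^o| <= k * `|lg n%:R : R^o|)%R by near: n; exact: H.
have hs : ((isqrt n)%:R <= Num.sqrt n%:R :> R)%R.
  have -> : ((isqrt n)%:R = Num.sqrt (isqrt n ^ 2)%:R :> R)%R.
    by rewrite natrX sqrtr_sqr ger0_norm // ler0n.
  by rewrite ler_sqrt ?ler0n // ler_nat isqrt_sqr_leq.
have h1 : (1 <= (isqrt n)%:R :> R)%R by rewrite ler1n isqrt_gt0.
have hB : ((block_total n)%:R <= (isqrt n)%:R + 3 :> R)%R.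
  by rewrite -natrD ler_nat addnS block_total_leq.
have hT := bucket_total_leq R n1.
have W0 : (0 <= (w n)%:R :> R)%R by rewrite ler0n.
have total : ((1 + 2 * block_total n + 4 * bucket_total n)%:R <=
    61 * Num.sqrt n%:R :> R)%R.
  rewrite !natrD !natrM; lra.
rewrite /extra_bits natrM normrM normrM.
rewrite (ger0_norm (sqrtr_ge0 _)) [leRHS]mulrA mulrC.
have -> : (k * 61 * Num.sqrt n%:R * `|lg n%:R| =
    61 * Num.sqrt n%:R * (k * `|lg n%:R|) :> R)%R by ring.
by apply: ler_pM => //; rewrite ?normr_ge0 // ger0_norm // ler0n.
Unshelve. all: by end_near. Qed.

(** * The extended representation *)

Lemma sumn_shape_group_arrays (w n : nat) (p : 'S_n) :
  sumn (shape (group_arrays w p)) =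
    w * (1 + 2 * block_total n + 4 * bucket_total n).
Proof. by rewrite /= !size_pack; ring. Qed.

Lemma power_representation_of_perm_representation (w s tf ti : nat -> nat) :
  (forall n, n < 2 ^ w n) -> perm_representation w s tf ti ->
  power_representation w (fun n => s n + extra_bits w n)
    (fun n => tf n + ti n + 37).
Proof.
move=> nw [enc [Pf [Pi [[a [len len_enc]] HP]]]].
(* The given programs may name arrays past the a existing ones, which read as empty. Padding with
   empty arrays up to [J] preserves this and costs no bits. *)
pose J := maxn a (maxn (array_bound Pf) (array_bound Pi)).
(* Lookup and rotation leave registers from 9 on alone. *)
pose K := maxn 9 (reg_bound Pi).
pose pad (n : nat) (p : 'S_n) := enc n p ++ nseq (J - a) [::].
have size_enc n (p : 'S_n) : size (enc n p) = a.
  have [_ /(_ p)] := len_enc n; rewrite -(size_map size) /shape => ->.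
  by rewrite size_tuple.
have size_pad n (p : 'S_n) : size (pad n p) = J.
  by rewrite size_cat size_nseq size_enc subnKC // leq_maxl.
pose enc' n (p : 'S_n) := pad n (layout_perm p) ++ group_arrays (w n) p.
(* The lengths do not depend on the permutation, so the identity serves as a sample. *)
pose len' n := shape (enc' n 1%g).
have shape_enc' n (p : 'S_n) : shape (enc' n p) = len' n.
  rewrite /len' /enc' /pad !/shape !map_cat -/shape.
  have [_ E] := len_enc n; rewrite -!/(shape (enc n _)) !E.
  by congr (_ ++ _); rewrite /= !size_pack.
have size_len' n : size (len' n) == J + 7.
  by rewrite size_map size_cat size_pad.
exists enc', (power_program K J Pf Pi); split.
  exists (J + 7), (fun n => Tuple (size_len' n)) => n.
  split; last exact: shape_enc'.
  rewrite /= /len' /enc' /pad /shape !map_cat !sumn_cat map_nseq sumn_nseq.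
  rewrite mul0n addn0.
  have [le E] := len_enc n.
  rewrite -/(shape (enc n _)) E -/(shape (group_arrays _ _)).
  by rewrite sumn_shape_group_arrays leq_add.
move=> n p i k kn.
have same P j : array_bound P <= J -> j < array_bound P ->
    nth [::] (enc n (layout_perm p)) j = nth [::] (enc' n p) j.
  move=> PJ /leq_trans /(_ PJ) jJ.
  rewrite /enc' nth_cat size_pad jJ nth_cat size_enc.
  by case: ltnP => // le; rewrite nth_nseq if_same nth_default ?size_enc.
apply: (@power_program_computes _ _ _ _ _ _ _ _ (enc n (layout_perm p))) => //.
- exact: leq_maxl.
- exact: leq_maxr.
- by move=> j; apply: same; rewrite /J !leq_max leqnn ?orbT.
- by move=> j; apply: same; rewrite /J !leq_max leqnn ?orbT.
- by move=> j; rewrite nth_cat size_pad ltnNge leq_addr addKn.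
- by move=> j; have [] := HP n (layout_perm p) j.
by move=> j; have [] := HP n (layout_perm p) j.
Qed.

Theorem theorem4 (R : realType) (w s tf ti : nat -> nat)
    (hw : word_size R w) (hR : perm_representation w s tf ti) :
  (exists e d : nat -> nat,
     ((fun n => (e n)%:R : R^o) =O_\oo
        (fun n => n%:R * lg n%:R / lg (lg n%:R) : R^o))%R /\
     ((fun n => (d n)%:R : R^o) =O_\oo (fun=> 1 : R^o))%R /\
     power_representation w (fun n => s n + e n) (fun n => tf n + ti n + d n))
  /\
  (exists e d : nat -> nat,
     ((fun n => (e n)%:R : R^o) =O_\oo
        (fun n => Num.sqrt n%:R * lg n%:R : R^o))%R /\
     ((fun n => (d n)%:R : R^o) =O_\oo (fun n => lg (lg n%:R) : R^o))%R /\
     power_representation w (fun n => s n + e n) (fun n => tf n + ti n + d n)).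
Proof.
have rep := power_representation_of_perm_representation (proj1 hw) hR.
have space := extra_bits_bigO hw.
split; exists (extra_bits w), (fun=> 37); split=> //.
- exact: bigO_lglg_div.
- by split=> //; apply: bigO_const_1.
- by split=> //; apply: bigO_const_lglg.
Qed.
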